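(* There exist $b_1,b_2\in L^\infty_{loc}(\mathbb{R})$ such that $C_bH=[b_2,[b_1,H]]$ is bounded on $L^2(\mathbb{R})$, but $S_{A,B}(b_1,b_2)=\infty$ and $T_C(b_1,b_2)=\infty$ for all log-bumps $A,B,C$ with $\bar A,\bar B,\bar C\in B_2$.
   Context: $H$ is the Hilbert transform $Hf(x)=\lim_{\varepsilon\to0}\int_{|x-y|>\varepsilon}\frac{f(y)}{x-y}dy$; $[A,B]=AB-BA$ with $b_i$ acting by multiplication; the commutator is defined on $L^\infty_c$ and bounded on $L^2$ means $\|C_bHf\|_2\le K\|f\|_2$ for $f\in L^\infty_c$. A log-bump is a function $\Phi(t)=t^p\log(e+t)^{p-1+\delta}$ on $[0,\infty)$ with $p\in(1,\infty)$, $\delta\in(0,\infty)$ (a Young function). For a Young function $A$: $\bar A(t)=\sup_{s>0}\{st-A(s)\}$; $A\in B_2$ means $\int_1^\infty\frac{A(t)}{t^2}\frac{dt}{t}<\infty$; $\langle|f|\rangle_{A,I}=\inf\{\lambda>0:\frac1{|I|}\int_IA(|f|/\lambda)\le1\}$. With $\langle g\rangle_I=\frac1{|I|}\int_Ig$ and suprema over intervals $I$: $S_{A,B}(b_1,b_2)=\sup_I\langle|b_1-\langle b_1\rangle_I|\rangle_{A,I}\langle|b_2-\langle b_2\rangle_I|\rangle_{B,I}$, $T_C(b_1,b_2)=\sup_I\langle|b_1-\langle b_1\rangle_I||b_2-\langle b_2\rangle_I|\rangle_{C,I}$. *)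

(* Defs.v *)
From HB Require Import structures.
From mathcomp Require Import all_boot all_order all_algebra.
From mathcomp Require Import all_classical all_reals all_analysis.
Set Implicit Arguments. Unset Strict Implicit. Unset Printing Implicit Defensive.
Import Order.TTheory GRing.Theory Num.Theory.
Import numFieldNormedType.Exports.
Local Open Scope classical_set_scope.
Local Open Scope ring_scope.

Section Defs.
Variable R : realType.
Local Notation mu := (@lebesgue_measure R).

Definition Linf_loc (b : R -> R) : Prop :=
  measurable_fun setT b /\
  forall a c : R, exists M : R,
    {ae mu, forall x, x \in `[a, c] -> `|b x| <= M}.

Definition Linf_c (f : R -> R) : Prop :=
  [/\ measurable_fun setT f,
      exists M : R, {ae mu, forall x, `|f x| <= M}
    & exists a c : R, forall x, x \notin `[a, c] -> f x = 0].

Definition hilbert_trunc (f : R -> R) (eps x : R) : R :=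
  Rintegral mu [set y | eps < `|x - y|] (fun y => f y / (x - y)).

Definition hilbert (f : R -> R) (x : R) : R :=
  lim (hilbert_trunc f eps x @[eps --> 0^'+]).

Definition commutator (b : R -> R) (T : (R -> R) -> (R -> R))
  : (R -> R) -> (R -> R) :=
  fun f x => b x * T f x - T (fun y => b y * f y) x.

Definition CbH (b1 b2 : R -> R) : (R -> R) -> (R -> R) :=
  commutator b2 (commutator b1 hilbert).

Definition L2norm (f : R -> R) : \bar R := Lnorm mu 2%:E (EFin \o f).

Definition L2_bounded (T : (R -> R) -> (R -> R)) : Prop :=
  exists K : R, forall f, Linf_c f ->
    (L2norm (T f) <= K%:E * L2norm f)%E.

Definition log_bump (p delta : R) (t : R) : R :=
  t `^ p * (ln (expR 1 + t)) `^ (p - 1 + delta).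

Definition is_log_bump (A : R -> R) : Prop :=
  exists p delta : R, 1 < p /\ 0 < delta /\ A = log_bump p delta.

Definition young_conj (A : R -> R) (t : R) : \bar R :=
  ereal_sup [set ((s * t - A s)%:E) | s in [set s : R | 0 < s]].

(* B_2 condition:  ∫_1^∞ A(t)/t^2 dt/t < ∞ *)
Definition B2 (A : R -> \bar R) : Prop :=
  (\int[mu]_(t in `[1%R, +oo[%classic) (A t * ((t ^+ 3)^-1)%:E) < +oo)%E.

Definition avg (a c : R) (g : R -> R) : R :=
  (c - a)^-1 * Rintegral mu `[a, c] g.

Definition lux_norm (A : R -> R) (a c : R) (f : R -> R) : \bar R :=
  ereal_inf [set (lam%:E) | lam in [set lam : R | 0 < lam /\
     (((c - a)^-1)%:E * \int[mu]_(y in `[a, c]) (A (`|f y| / lam))%:E <= 1)%E]].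

Definition osc (b : R -> R) (a c : R) : R -> R :=
  fun y => `|b y - avg a c b|.

Definition S_AB (A B : R -> R) (b1 b2 : R -> R) : \bar R :=
  ereal_sup [set (lux_norm A I.1 I.2 (osc b1 I.1 I.2) *
                  lux_norm B I.1 I.2 (osc b2 I.1 I.2))%E
            | I in [set I : R * R | I.1 < I.2]].

Definition T_C (C : R -> R) (b1 b2 : R -> R) : \bar R :=
  ereal_sup [set lux_norm C I.1 I.2
                   (fun y => osc b1 I.1 I.2 y * osc b2 I.1 I.2 y)
            | I in [set I : R * R | I.1 < I.2]].
End Defs.

(* Main.v *)
Require Import Defs.
From mathcomp Require Import all_boot all_order all_algebra.
From mathcomp Require Import all_classical all_reals all_analysis.
From mathcomp Require Import measurable_realfun lra ring.
Set Implicit Arguments. Unset Strict Implicit. Unset Printing Implicit Defensive.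
Import Order.TTheory GRing.Theory Num.Theory.
Import numFieldNormedType.Exports.
Local Open Scope classical_set_scope.
Local Open Scope ring_scope.

(** Let [b2] be the indicator of the negative half-line and [b1] a function in L2
    supported in [[1, oo)].  Since [b1 b2 = 0], [C_b H f] reduces to
    [- b1 H(b2 f) - b2 H(b1 f)].  As the supports are at distance [1], no principal
    value is involved: the two kernels are dominated by tensor products of L2
    functions, and Cauchy-Schwarz gives the L2 bound.

    On [[-L, L]] the oscillation of [b2] is constantly [1/2], so that both [S] and
    [T] reduce to the Luxemburg norm of the oscillation of [b1].  If [p < 2], the
    conjugate of a log-bump is at least quadratic at infinity; hence [B_2] forces
    [p >= 2], and the log-bump dominates [t^2 log t].  Placing in [b1], at each
    positive integer, a very high spike of squared L2 norm [2^-(n+1)] makes the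
    logarithm beat both [2^-(n+1)] and the length of the interval. *)

Lemma ereal_sup_linear_pinfty (R : realType) (S : set \bar R) (k : R) : 0 < k ->
  (forall n, exists2 x, S x & ((k * n.+1%:R)%:E <= x)%E) -> ereal_sup S = +oo%E.
Proof.
move=> k0 Sk; apply: eq_infty => r.
have [x Sx kx] := Sk (Num.truncn (r / k)).
apply: le_trans (ereal_sup_ubound Sx); apply: le_trans kx.
by rewrite lee_fin mulrC -ler_pdivrMr//; exact/ltW/truncnS_gt.
Qed.

Section integral_no_measurability.
Context d (T : measurableType d) (R : realType) (mu : {measure set T -> \bar R}).
Implicit Types (D : set T) (f g : T -> \bar R).
Local Open Scope ereal_scope.

Lemma ge0_le_integral_nomeas D f g :
  (forall x, D x -> 0 <= f x) -> (forall x, D x -> f x <= g x) ->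
  \int[mu]_(x in D) f x <= \int[mu]_(x in D) g x.
Proof.
move=> f0 fg.
rewrite !ge0_integralE//; last by move=> x Dx; exact: le_trans (f0 _ Dx) (fg _ Dx).
apply: ereal_sup_le => _ [h /= hf <-].
by exists h => //= x; apply: (le_trans (hf x)); exact: lee_restrict.
Qed.

Lemma normr_fine_integral_le D f :
  `|fine (\int[mu]_(x in D) f x)|%:E <= \int[mu]_(x in D) `|f x|.
Proof.
rewrite integralE; set P := integral _ _ _; set N := integral _ _ _.
have P0 : 0 <= P by exact: integral_ge0.
have N0 : 0 <= N by exact: integral_ge0.
have [PI NI] : P <= \int[mu]_(x in D) `|f x| /\ N <= \int[mu]_(x in D) `|f x|.
  by split; apply: ge0_le_integral_nomeas => // x _;
    rewrite -/((abse \o f) x) fune_abse ?leeDl ?leeDr.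
move: (\int[mu]_(x in D) _) P N P0 N0 PI NI => I [p| |] [n| |]//= P0 N0 PI NI;
  rewrite ?normr0 ?(le_trans P0 PI) ?(le_trans N0 NI)//.
rewrite !lee_fin in P0 N0; have [np|pn] := leP n p.
  by apply: le_trans PI; rewrite lee_fin ler_norml; lra.
by apply: le_trans NI; rewrite lee_fin ler_norml; lra.
Qed.

End integral_no_measurability.

Section Lnorm_theory.
Context d (T : measurableType d) (R : realType) (mu : {measure set T -> \bar R}).
Variables (p : R) (p0 : 0 < p).
Local Open Scope ereal_scope.

Lemma Lnorm_le (f g : T -> \bar R) : (forall x, `|f x| <= `|g x|) ->
  'N[mu]_p%:E[f] <= 'N[mu]_p%:E[g].
Proof.
move=> fg; rewrite unlock.
have I0 h : 0 <= \int[mu]_x `|h x : \bar R| `^ p.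
  by apply: integral_ge0 => x _; exact: poweR_ge0.
apply: gt0_ler_poweR; rewrite ?in_itv/= ?leey ?I0 ?invr_ge0 ?(ltW p0)//.
apply: ge0_le_integral_nomeas => x _; first exact: poweR_ge0.
by apply: gt0_ler_poweR; rewrite ?in_itv/= ?leey ?abse_ge0 ?(ltW p0)//.
Qed.

Lemma Lnorm_scale (k : R) (f : T -> R) : measurable_fun setT f ->
  'N[mu]_p%:E[EFin \o (fun x => k * f x)%R] = `|k|%:E * 'N[mu]_p%:E[EFin \o f].
Proof.
move=> mf; rewrite unlock.
under eq_integral do rewrite /= normrM powRM// EFinM.
have powI0 x : 0 <= (`|f x| `^ p)%:E by rewrite lee_fin powR_ge0.
rewrite ge0_integralZl_EFin ?powR_ge0//; last first.
  apply/measurable_EFinP; apply: (measurableT_comp (measurable_powR p)).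
  exact: measurableT_comp.
rewrite poweRM ?lee_fin ?powR_ge0 ?integral_ge0//.
by rewrite poweR_EFin -powRrM divff ?gt_eqF// powRr1.
Qed.

End Lnorm_theory.

Section inverse.
Variable R : realType.
Local Notation mu := (@lebesgue_measure R).

Lemma measurable_invr : measurable_fun setT (@GRing.inv R).
Proof.
rewrite (_ : @GRing.inv R = fun x => x * (x ^+ 2) `^ (-1)).
  apply: measurable_funM => //.
  exact: (measurableT_comp (measurable_powR (-1)) (@exprn_measurable R setT 2)).
apply/funext => x; rewrite powR_inv1 ?sqr_ge0// expr2 invfM.
by have [->|x0] := eqVneq x 0; rewrite ?invr0 ?mul0r// mulrA divff ?mul1r.
Qed.

Lemma integral_invr_itv (a b : R) : 0 < a -> a < b ->
  (\int[mu]_(t in `[a, b]) (t^-1)%:E = (ln b - ln a)%:E)%E.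
Proof.
move=> a0 ab; rewrite (@continuous_FTC2 R (fun t => t^-1) (@ln R) a b ab).
- by rewrite EFinB.
- apply: continuous_in_subspaceT => t; rewrite inE/= in_itv/= => /andP[ta _].
  by apply: inv_continuous; rewrite gt_eqF//; lra.
- split.
  + move=> t; rewrite in_itv/= => /andP[ta _].
    by apply: ex_derive; apply: is_derive1_ln; lra.
  + by apply: cvg_at_right_filter; exact: continuous_ln.
  + by apply: cvg_at_left_filter; apply: continuous_ln; lra.
- move=> t; rewrite in_itv/= => /andP[ta _].
  by rewrite derive1E; apply: derive_val; apply: is_derive1_ln; lra.
Qed.

Lemma integral_invr_pinfty (a : R) : 0 < a ->
  (\int[mu]_(t in `[a, +oo[) (t^-1)%:E = +oo)%E.
Proof.
move=> a0; apply: eq_infty => r.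
pose b := a * expR (Num.max 1 r).
have ab : a < b by rewrite /b ltr_pMr// expR_gt1 lt_max ltr01.
apply: (@le_trans _ _ (\int[mu]_(t in `[a, b]) (t^-1)%:E)%E).
  rewrite integral_invr_itv// /b lnM ?posrE ?expR_gt0// expRK lee_fin.
  by rewrite addrAC subrr add0r le_max lexx orbT.
apply: ge0_subset_integral => //.
- by apply/measurable_EFinP; apply: measurable_funTS; exact: measurable_invr.
- by move=> t; rewrite /= in_itv/= andbT => at_; rewrite lee_fin invr_ge0; lra.
- by move=> t; rewrite /= !in_itv/= andbT => /andP[].
Qed.

End inverse.

Section L2.
Variable R : realType.
Local Notation mu := (@lebesgue_measure R).
Implicit Types f g : R -> R.

Lemma L2normE f : L2norm f = ((\int[mu]_x (f x ^+ 2)%:E) `^ 2^-1)%E.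
Proof.
rewrite /L2norm unlock; congr (_ `^ _)%E.
by apply: eq_integral => x _ /=; rewrite powR_mulrn// real_normK ?num_real.
Qed.

Lemma L2norm_fin_num f :
  (\int[mu]_x (f x ^+ 2)%:E < +oo)%E -> L2norm f \is a fin_num.
Proof. by move=> f2; rewrite ge0_fin_numE ?Lnorm_ge0// L2normE poweR_lty. Qed.

Lemma Linf_c_L2norm_fin_num f : Linf_c f -> L2norm f \is a fin_num.
Proof.
move=> [mf [M fM] [a [c fac]]]; apply: L2norm_fin_num.
have mf2 : measurable_fun setT (fun x => (f x ^+ 2)%:E).
  by apply/measurable_EFinP; exact: measurable_funX.
apply: (@le_lt_trans _ _ (\int[mu]_(x in `[a, c]) (cst (M ^+ 2)%:E x))%E).
  rewrite [leRHS]integral_mkcond; apply: ae_ge0_le_integral => //.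
  - by move=> x _; rewrite lee_fin sqr_ge0.
  - by move=> x _; rewrite patchE; case: ifP => // _; rewrite lee_fin sqr_ge0.
  - by apply/(measurable_restrictT _ _).1 => //; exact: measurable_itv.
  apply: (@filterS _ (almost_everywhere mu) _ _ _ _ fM) => x fxM _.
  rewrite patchE mem_setE.
  have [_|xac] := boolP (x \in `[a, c]); last by rewrite fac// expr0n.
  by rewrite lee_fin -(real_normK (num_real (f x))) lerXn2r ?nnegrE ?(le_trans _ fxM).
rewrite integral_cst//= lebesgue_measure_itv/=.
by case: ifP => _; rewrite ?mule0 ?ltry// -EFinB -EFinM ltry.
Qed.

Lemma cauchy_schwarz_L2 f g : measurable_fun setT f -> measurable_fun setT g ->
  (\int[mu]_x (`|f x| * `|g x|)%:E <= L2norm f * L2norm g)%E.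
Proof.
move=> mf mg; have half2 : (2^-1 + 2^-1 = 1 :> R) by lra.
apply: le_trans (hoelder mu mf mg (ltr0Sn _ 1) (ltr0Sn _ 1) half2).
by rewrite Lnorm1; under [leRHS]eq_integral do rewrite /= normrM.
Qed.

Lemma normr_avg_le_L2norm a c g : 1 <= c - a -> measurable_fun setT g ->
  (`|avg a c g|%:E <= L2norm g)%E.
Proof.
move=> ac mg; have ca0 : 0 < c - a by lra.
rewrite /avg /Rintegral normrM gtr0_norm ?invr_gt0// EFinM lee_pdivrMl//.
apply: le_trans (normr_fine_integral_le _ _ _) _.
rewrite integral_mkcond.
pose ind : R -> R := \1_(`[a, c]%classic).
have mind : measurable_fun setT ind by exact: measurable_indic.
have sqr_ind x : ind x ^+ 2 = ind x.
  by rewrite /ind indicE; case: (_ \in _); rewrite ?expr1n ?expr0n.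
apply: (@le_trans _ _ (L2norm ind * L2norm g)%E).
  apply: le_trans (cauchy_schwarz_L2 mind mg).
  apply: ge0_le_integral_nomeas => x _; rewrite patchE.
    by case: ifP.
  by rewrite /ind indicE; case: ifP => _; rewrite ?normr1 ?mul1r// normr0 mul0r.
apply: lee_wpmul2r; first exact: Lnorm_ge0.
rewrite L2normE; under eq_integral do rewrite sqr_ind.
rewrite integral_indic// setIT [X in (X `^ _)%E]lebesgue_measure_itv/=.
rewrite lte_fin ifT; last lra.
by rewrite -EFinB poweR_EFin lee_fin ler1_powR// invf_le1// ler1n.
Qed.

End L2.

Section hilbert_transform.
Variable R : realType.
Local Notation mu := (@lebesgue_measure R).
Implicit Types f b u v : R -> R.

(* If the truncated integrals diverge, [lim] is the default point [0]. *)
Lemma norm_hilbert_le f x :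
  (`|hilbert f x|%:E <= \int[mu]_y (`|f y| / `|x - y|)%:E)%E.
Proof.
set I := (X in (_ <= X)%E).
have I0 : (0 <= I)%E by apply: integral_ge0 => y _; rewrite lee_fin divr_ge0.
have trunc_le eps : (`|hilbert_trunc f eps x|%:E <= I)%E.
  apply: le_trans (normr_fine_integral_le _ _ _) _.
  rewrite integral_mkcond; apply: ge0_le_integral_nomeas => y _.
    by rewrite patchE; case: ifP.
  rewrite patchE; case: ifP => _; last by rewrite lee_fin divr_ge0.
  by rewrite lee_fin normrM normfV.
case: I I0 trunc_le => [M| |]// M0 trunc_le; last by rewrite leey.
rewrite lee_fin /hilbert.
have [cf|/dvgP ->] := pselect (cvg (hilbert_trunc f eps x @[eps --> 0^'+])).
  rewrite -lim_norm//; apply: limr_le; first exact: is_cvg_norm.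
  by apply: nearW => eps; rewrite -lee_fin.
by rewrite /point/= normr0 -lee_fin.
Qed.

Lemma hilbert0 x : hilbert (fun=> 0) x = 0 :> R.
Proof.
apply/eqP; rewrite -normr_le0 -lee_fin; apply: le_trans (norm_hilbert_le _ _) _.
by under eq_integral do rewrite normr0 mul0r; rewrite integral0.
Qed.

(* The kernel [a x * b y / (x - y)] of [f |-> a * H (b f)] is dominated by
   [u x * v y]; on the diagonal the condition says that [a * b = 0]. *)
Definition cauchy_kernel_le (a b u v : R -> R) :=
  forall x y, `|a x * b y| <= u x * v y * `|x - y|.

Lemma cauchy_kernel_leC a b u v :
  cauchy_kernel_le a b u v -> cauchy_kernel_le b a v u.
Proof. by move=> abuv x y; rewrite mulrC (mulrC (v x)) distrC. Qed.

Lemma cauchy_kernel_le_mul0 a b u v x :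
  cauchy_kernel_le a b u v -> a x * b x = 0.
Proof.
by move=> /(_ x x); rewrite subrr normr0 mulr0 normr_le0 => /eqP.
Qed.

Lemma norm_mul_hilbert_le a b u v f x :
  measurable_fun setT v -> measurable_fun setT f ->
  0 <= u x -> (forall y, 0 <= v y) -> cauchy_kernel_le a b u v ->
  (`|a x * hilbert (fun y => b y * f y) x|%:E
    <= (u x)%:E * (L2norm v * L2norm f))%E.
Proof.
move=> meas_v meas_f u0 v0 abuv; have [->|ax0] := eqVneq (a x) 0.
  by rewrite mul0r normr0 !mule_ge0 ?Lnorm_ge0.
rewrite normrM EFinM.
have a0 : 0 < `|a x| by rewrite normr_gt0.
rewrite -lee_pdivlMl//; apply: le_trans (norm_hilbert_le _ _) _.
rewrite muleA -EFinM.
have c0 : 0 <= `|a x|^-1 * u x by rewrite mulr_ge0 ?invr_ge0.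
apply: le_trans (lee_wpmul2l _ (cauchy_schwarz_L2 meas_v meas_f)) => //.
rewrite -ge0_integralZl_EFin//; last first.
  by apply/measurable_EFinP; apply: measurable_funM; exact: measurableT_comp.
apply: ge0_le_integral_nomeas => y _; first by rewrite lee_fin divr_ge0.
have [<-|xy] := eqVneq x y.
  by rewrite subrr normr0 invr0 mulr0 mule_ge0 ?lee_fin// mulr_ge0.
rewrite -EFinM lee_fin ler_pdivrMr ?normr_gt0 ?subr_eq0// normrM (ger0_norm (v0 y)).
rewrite -(ler_pM2l a0) mulrA -normrM.
apply: le_trans (ler_wpM2r (normr_ge0 (f y)) (abuv x y)) _.
by rewrite le_eqVlt; apply/orP; left; apply/eqP; field; rewrite normr_eq0.
Qed.

Lemma CbH_disjoint b1 b2 f x : (forall y, b1 y * b2 y = 0) ->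
  CbH b1 b2 f x = - (b1 x * hilbert (fun y => b2 y * f y) x +
                     b2 x * hilbert (fun y => b1 y * f y) x).
Proof.
move=> b120; rewrite /CbH /commutator.
rewrite (_ : (fun y => b1 y * (b2 y * f y)) = fun=> 0); last first.
  by apply/funext => y; rewrite mulrA b120 mul0r.
rewrite hilbert0 mulrBr mulrA (mulrC (b2 x)) b120.
by ring.
Qed.

Lemma L2norm_CbH_le b1 b2 u v f :
  measurable_fun setT u -> measurable_fun setT v -> measurable_fun setT f ->
  (forall x, 0 <= u x) -> (forall x, 0 <= v x) -> cauchy_kernel_le b1 b2 u v ->
  L2norm u \is a fin_num -> L2norm v \is a fin_num -> L2norm f \is a fin_num ->
  (L2norm (CbH b1 b2 f) <= 2%:E * (L2norm u * L2norm v) * L2norm f)%E.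
Proof.
move=> meas_u meas_v meas_f u0 v0 buv.
have b1_bound x := norm_mul_hilbert_le meas_v meas_f (u0 x) v0 buv.
have b2_bound x :=
  norm_mul_hilbert_le meas_u meas_f (v0 x) u0 (cauchy_kernel_leC buv).
move=> /fineK uE /fineK vE /fineK fE.
set U := fine _ in uE; set V := fine _ in vE; set F := fine _ in fE.
have [U0 V0 F0] : [/\ 0 <= U, 0 <= V & 0 <= F] by rewrite !fine_ge0 ?Lnorm_ge0.
pose G x := (F * V) * u x + (F * U) * v x.
apply: (@le_trans _ _ (L2norm G)).
  apply: Lnorm_le => // x; rewrite /= lee_fin.
  rewrite CbH_disjoint; last by move=> y; exact: cauchy_kernel_le_mul0 buv.
  rewrite normrN (@ger0_norm _ (G x)) ?addr_ge0 ?mulr_ge0//.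
  apply: le_trans (ler_normD _ _) _; rewrite /G lerD// -lee_fin.
    by apply: le_trans (b1_bound x) _; rewrite -vE -fE -!EFinM lee_fin; lra.
  by apply: le_trans (b2_bound x) _; rewrite -uE -fE -!EFinM lee_fin; lra.
have mFu : measurable_fun setT (fun x => F * V * u x) by exact: measurable_funM.
have mFv : measurable_fun setT (fun x => F * U * v x) by exact: measurable_funM.
apply: le_trans (eminkowski mu mFu mFv (_ : (1 <= 2%:E)%E)) _.
  by rewrite lee_fin; lra.
rewrite !Lnorm_scale// -/(L2norm u) -/(L2norm v) -uE -vE -fE !ger0_norm ?mulr_ge0//.
by rewrite -!EFinM -EFinD lee_fin; lra.
Qed.

Lemma L2_bounded_CbH b1 b2 u v :
  measurable_fun setT u -> measurable_fun setT v ->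
  (forall x, 0 <= u x) -> (forall x, 0 <= v x) -> cauchy_kernel_le b1 b2 u v ->
  L2norm u \is a fin_num -> L2norm v \is a fin_num ->
  L2_bounded (CbH b1 b2).
Proof.
move=> meas_u meas_v u0 v0 buv ufin vfin.
exists (2 * (fine (L2norm u) * fine (L2norm v))) => f cf.
rewrite !EFinM !fineK//; apply: L2norm_CbH_le => //; first by case: cf.
exact: Linf_c_L2norm_fin_num.
Qed.

End hilbert_transform.

Section half_line.
Variable R : realType.
Implicit Types (b : R -> R) (x y : R).

Definition half_line : R -> R := \1_(`]-oo, 0[%classic).

Lemma half_lineE x : half_line x = (x < 0)%R%:R.
Proof. by rewrite /half_line indicE mem_setE in_itv. Qed.

Lemma Linf_loc_half_line : Linf_loc half_line.
Proof.
split; first exact: measurable_indic.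
move=> a c; exists 1; apply: aeW => x _.
by rewrite half_lineE; case: (x < 0); rewrite ?normr1 ?normr0.
Qed.

Lemma osc_half_line (L : R) y : 0 < L -> osc half_line (- L) L y = 2^-1.
Proof.
move=> L0; rewrite /osc (_ : avg _ _ _ = 2^-1).
  by rewrite half_lineE; case: ltP => _ /=; rewrite ?sub0r ?normrN ger0_norm; lra.
rewrite /avg /Rintegral /half_line integral_indic//.
rewrite (_ : _ `&` _ = `[- L, 0[%classic); last first.
  apply/seteqP; split=> x /=; rewrite !in_itv/=.
    by move=> [-> /andP[-> _]].
  by move=> /andP[-> x0]; rewrite x0; split=> //=; lra.
rewrite [X in fine X]lebesgue_measure_itv/= lte_fin oppr_lt0 L0 -EFinB/=.
by field; rewrite !gt_eqF//; lra.
Qed.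

Definition japanese_inv x : R := Num.sqrt (oneDsqr x)^-1.

Lemma measurable_japanese_inv : measurable_fun setT japanese_inv.
Proof.
apply: (measurableT_comp (continuous_measurable_fun (@sqrt_continuous R))).
exact: continuous_measurable_fun (@continuous_oneDsqrV R).
Qed.

Lemma L2norm_japanese_inv_fin_num : L2norm japanese_inv \is a fin_num.
Proof.
have oneDsqrV_ge0 x : 0 <= (oneDsqr x)^-1.
  by rewrite invr_ge0 (le_trans ler01)// oneDsqr_ge1.
apply: L2norm_fin_num; under eq_integral do rewrite sqr_sqrtr//.
rewrite (@ge0_symfun_integralT _ (fun x => (oneDsqr x)^-1))//.
- rewrite (_ : [set x | 0 <= x] = `[0, +oo[%classic); last first.
    by apply/seteqP; split=> x /=; rewrite in_itv/= andbT.
  by rewrite integral0y_oneDsqr -EFinM ltry.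
- exact: continuous_oneDsqrV.
- by move=> x /=; rewrite /oneDsqr sqrrN.
Qed.

Lemma japanese_inv_mul_dist_ge1 x y : 1 <= x -> y < 0 ->
  1 <= japanese_inv y * (x - y).
Proof.
move=> x1 y0; have d1 := oneDsqr_ge1 y.
have d0 : 0 < Num.sqrt (oneDsqr y) by rewrite sqrtr_gt0; lra.
rewrite /japanese_inv sqrtrV; last lra.
rewrite mulrC ler_pdivlMr// mul1r.
rewrite -(@ler_pXn2r _ 2)// ?nnegrE ?sqrtr_ge0//; last lra.
by rewrite sqr_sqrtr /oneDsqr; nra.
Qed.

Lemma cauchy_kernel_le_half_line b : (forall y, y < 1 -> b y = 0) ->
  cauchy_kernel_le b half_line (fun x => `|b x|) japanese_inv.
Proof.
move=> b0 x y; rewrite half_lineE normrM -mulrA.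
have [/b0->|x1] := ltP x 1; first by rewrite normr0 !mul0r.
rewrite ler_wpM2l//; have [y0|_] := ltP y 0; last first.
  by rewrite normr0 mulr_ge0 ?sqrtr_ge0.
by rewrite normr1 gtr0_norm ?japanese_inv_mul_dist_ge1//; lra.
Qed.

Lemma L2_bounded_CbH_half_line b : measurable_fun setT b ->
  (forall y, y < 1 -> b y = 0) -> L2norm b \is a fin_num ->
  L2_bounded (CbH b half_line).
Proof.
move=> mb b0 bfin; apply: (@L2_bounded_CbH _ _ _ (fun x => `|b x|) japanese_inv).
- exact: measurableT_comp.
- exact: measurable_japanese_inv.
- by [].
- by move=> x; exact: sqrtr_ge0.
- exact: cauchy_kernel_le_half_line.
- by rewrite /L2norm (_ : EFin \o _ = abse \o (EFin \o b)) ?Lnorm_abse.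
- exact: L2norm_japanese_inv_fin_num.
Qed.

End half_line.

Section young_conj_B2.
Variable R : realType.
Implicit Types (A : R -> R) (s t : R).

Lemma young_conj_ge A s t : 0 < s -> ((s * t - A s)%:E <= young_conj A t)%E.
Proof. by move=> s0; apply: ereal_sup_ubound; exists s. Qed.

Lemma young_conj_ge0 A (C t : R) : (forall s, 0 < s <= 1 -> A s <= C * s) ->
  0 <= t -> (0 <= young_conj A t)%E.
Proof.
move=> AC t0; apply/lee_addgt0Pr => e e0.
pose s := Num.min 1 (e / (`|C| + 1)).
have C1 : 0 < `|C| + 1 by rewrite ltr_wpDl.
have s0 : 0 < s by rewrite lt_min ltr01 divr_gt0.
have sC : C * s <= e.
  apply: (@le_trans _ _ ((`|C| + 1) * s)).
    by rewrite ler_wpM2r ?(ltW s0)// (le_trans (ler_norm C))// lerDl.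
  by rewrite mulrC -ler_pdivlMr// ge_min lexx orbT.
apply: le_trans (leeD2r _ (young_conj_ge A t s0)).
have As : A s <= C * s by apply: AC; rewrite s0 ge_min lexx.
have st : 0 <= s * t by rewrite mulr_ge0// ltW.
by rewrite -EFinD lee_fin; lra.
Qed.

Lemma young_conj_ge_sqr A (M t : R) : 0 < M ->
  (forall s, 1 <= s -> A s <= M * s ^+ 2) -> 2 * M <= t ->
  (((4 * M)^-1 * t ^+ 2)%:E <= young_conj A t)%E.
Proof.
move=> M0 AM Mt; pose s := t / (2 * M).
have s1 : 1 <= s by rewrite ler_pdivlMr ?mul1r// mulr_gt0.
apply: le_trans (@young_conj_ge A s t _); last lra.
rewrite lee_fin; have := AM _ s1.
have -> : M * s ^+ 2 = (4 * M)^-1 * t ^+ 2 by rewrite /s; field; rewrite gt_eqF.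
have -> : s * t = 2 * ((4 * M)^-1 * t ^+ 2) by rewrite /s; field; rewrite gt_eqF.
lra.
Qed.

Lemma not_B2_ge_sqr (A : R -> \bar R) (k T : R) : 0 < k -> 1 <= T ->
  (forall t, 1 <= t -> (0 <= A t)%E) ->
  (forall t, T <= t -> ((k * t ^+ 2)%:E <= A t)%E) -> ~ B2 A.
Proof.
move=> k0 T1 A0 Ak; rewrite /B2; set I := (X in (X < _)%E).
suff -> : I = +oo%E by rewrite ltxx.
apply/eqP; rewrite -leye_eq.
rewrite -(gt0_muley (_ : (0 < k%:E)%E)) ?lte_fin//.
rewrite -(@integral_invr_pinfty _ T); last lra.
rewrite -ge0_integralZl_EFin//; last 3 first.
- by move=> t; rewrite /= in_itv/= andbT => Tt; rewrite lee_fin invr_ge0; lra.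
- by apply/measurable_EFinP; apply: measurable_funTS; exact: measurable_invr.
- exact: ltW.
rewrite (_ : `[T, +oo[%classic = `[1, +oo[%classic `&` `[T, +oo[%classic); last first.
  by rewrite setIidr// => t /=; rewrite !in_itv/= !andbT; lra.
rewrite integral_mkcondr; apply: ge0_le_integral_nomeas => t /=;
  rewrite in_itv/= andbT => t1; rewrite patchE.
  by case: ifP => // _; rewrite -EFinM lee_fin mulr_ge0 ?invr_ge0 ?(ltW k0)//; lra.
have t3 : (0 <= ((t ^+ 3)^-1)%:E)%E by rewrite lee_fin invr_ge0 exprn_ge0//; lra.
case: ifPn => [|_]; last by rewrite mule_ge0 ?A0.
rewrite inE/= in_itv/= andbT => Tt.
have -> : (k%:E * (t^-1)%:E = (k * t ^+ 2)%:E * ((t ^+ 3)^-1)%:E)%E.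
  by rewrite -!EFinM; congr EFin; field; rewrite gt_eqF//; lra.
by apply: lee_wpmul2r => //; exact: Ak.
Qed.

End young_conj_B2.

Section lux_norm.
Variable R : realType.
Local Notation mu := (@lebesgue_measure R).

Lemma lux_norm_ge (A f : R -> R) (a c k s : R) (E : set R) :
  a < c -> (forall t, 0 <= A t) -> {in Num.nneg &, {homo A : t u / t <= u}} ->
  measurable E -> E `<=` `[a, c] -> 0 < k -> 0 < s ->
  (forall y, E y -> k * s <= `|f y|) -> ((c - a)%:E < (A s)%:E * mu E)%E ->
  (k%:E <= lux_norm A a c f)%E.
Proof.
move=> ac A0 Ahomo mE Eac k0 s0 fks AE.
apply: le_ereal_inf_tmp => _ [lam [lam0 +] <-].
rewrite lee_pdivrMl ?subr_gt0// mule1 => int_le.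
rewrite lee_fin leNgt; apply/negP => lamk; move: AE; rewrite ltNge => /negP; apply.
apply: le_trans int_le; rewrite -integral_cst// -(setIidr Eac).
rewrite integral_mkcondr; apply: ge0_le_integral_nomeas => y _; rewrite patchE.
  by case: ifP => // _; rewrite lee_fin.
case: ifPn => [|_]; last by rewrite lee_fin.
rewrite inE => Ey; rewrite lee_fin; apply: Ahomo.
- by rewrite nnegrE ltW.
- by rewrite nnegrE divr_ge0// ltW.
- rewrite ler_pdivlMr//; apply: le_trans (fks _ Ey).
  by rewrite mulrC ler_wpM2r// ltW.
Qed.

Lemma lux_norm_scale (A f : R -> R) (a c k : R) : 0 < k ->
  lux_norm A a c (fun y => k * f y) = (k%:E * lux_norm A a c f)%E.
Proof.
move=> k0; rewrite /lux_norm -ereal_inf_pZl//; congr ereal_inf.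
have scaleE lam y : `|k * f y| / (k * lam) = `|f y| / lam.
  by rewrite normrM gtr0_norm// -mulf_div divff ?mul1r// gt_eqF.
apply/seteqP; split=> [_ [lam [lam0 int_le] <-]|_ [_ [lam [lam0 int_le] <-] <-]].
  exists (lam / k)%:E; last by rewrite -EFinM mulrC divfK// gt_eqF.
  exists (lam / k) => //; split; first exact: divr_gt0.
  under eq_integral do rewrite -scaleE mulrCA divff ?gt_eqF// mulr1.
  exact: int_le.
exists (k * lam); last by rewrite EFinM.
split; first exact: mulr_gt0.
by under eq_integral do rewrite scaleE.
Qed.

End lux_norm.

Section log_bump.
Variable R : realType.
Implicit Types s t : R.

Lemma ln_eD_ge1 t : 0 <= t -> 1 <= ln (expR 1 + t).
Proof.
move=> t0; rewrite -[leLHS]expRK ler_ln ?posrE ?expR_gt0 ?ltr_wpDr ?expR_gt0//.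
by rewrite lerDl.
Qed.

Lemma powR_ln_le (a e x : R) : 0 < a -> 0 < e -> 1 <= x ->
  ln x `^ a <= (a / e) `^ a * x `^ e.
Proof.
move=> a0 e0 x1; have x0 : 0 < x by lra.
have ae0 : 0 < a / e by exact: divr_gt0.
have -> : x `^ e = (x `^ (e / a)) `^ a by rewrite -powRrM divfK// gt_eqF.
rewrite -powRM ?(ltW ae0) ?powR_ge0//.
apply: ge0_ler_powR.
- exact: ltW.
- by rewrite nnegrE ln_ge0.
- by rewrite nnegrE mulr_ge0 ?powR_ge0 ?(ltW ae0).
rewrite mulrC -ler_pdivrMr// invf_div mulrC -ln_powR.
by apply/ltW/ln_sublinear; rewrite powR_gt0.
Qed.

Variables p delta : R.
Hypotheses (p_gt1 : 1 < p) (delta_gt0 : 0 < delta).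

Let p_ge0 : 0 <= p. Proof. exact: le_trans ler01 (ltW p_gt1). Qed.

Let exponent_gt0 : 0 < p - 1 + delta.
Proof. by rewrite addr_gt0 ?subr_gt0. Qed.

Lemma log_bump_ge0 t : 0 <= log_bump p delta t.
Proof. by rewrite mulr_ge0 ?powR_ge0. Qed.

Let powR_ln_homo s t : 0 <= s -> s <= t ->
  ln (expR 1 + s) `^ (p - 1 + delta) <= ln (expR 1 + t) `^ (p - 1 + delta).
Proof.
move=> s0 st; have t0 := le_trans s0 st.
have lns := ln_eD_ge1 s0; have lnt := ln_eD_ge1 t0.
apply: ge0_ler_powR; rewrite ?nnegrE ?(ltW exponent_gt0) ?(le_trans ler01)//.
by rewrite ler_ln ?posrE ?ltr_wpDr ?expR_gt0// lerD2l.
Qed.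

Lemma log_bump_homo : {in Num.nneg &, {homo log_bump p delta : s t / s <= t}}.
Proof.
move=> s t; rewrite !nnegrE => s0 t0 st.
apply: ler_pM; rewrite ?powR_ge0 ?powR_ln_homo//.
by apply: ge0_ler_powR; rewrite ?nnegrE ?p_ge0.
Qed.

Lemma log_bump_ge_powR t : 0 <= t -> t `^ p <= log_bump p delta t.
Proof.
move=> t0; rewrite ler_peMr ?powR_ge0//.
by rewrite -[leLHS](powRr0 (ln (expR 1 + t))) ler_powR ?ln_eD_ge1 ?(ltW exponent_gt0).
Qed.

Lemma log_bump_ge_sqr_ln s : 2 <= p -> 1 <= s ->
  s ^+ 2 * ln s <= log_bump p delta s.
Proof.
move=> p2 s1; have s0 : 0 < s by lra.
apply: ler_pM; [exact: sqr_ge0|exact: ln_ge0| |].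
  by rewrite -powR_mulrn ?(ltW s0)//; apply: ler_powR.
apply: (@le_trans _ _ (ln (expR 1 + s))).
  by rewrite ler_ln ?posrE// ?ltr_wpDl ?ltr_wpDr ?expR_gt0 ?expR_ge0// lerDr expR_ge0.
by apply: le1r_powR; [exact: ln_eD_ge1 (ltW s0)|have := delta_gt0; lra].
Qed.

Lemma log_bump_le_linear s : 0 < s <= 1 ->
  log_bump p delta s <= log_bump p delta 1 * s.
Proof.
move=> /andP[s0 s1]; rewrite /log_bump powR1 mul1r mulrC.
apply: ler_pM; rewrite ?powR_ge0 ?powR_ln_homo ?(ltW s0)//.
by apply: ge1r_powR; [rewrite s0 s1|exact: ltW].
Qed.

Lemma log_bump_le_powR q : p < q ->
  exists2 M, 0 < M & forall s, 1 <= s -> log_bump p delta s <= M * s `^ q.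
Proof.
move=> pq; have a0 := exponent_gt0; set a := p - 1 + delta in a0.
pose e := q - p; have e0 : 0 < e by rewrite /e; lra.
have e1 := expR_gt0 (1 : R).
exists ((a / e) `^ a * (expR 1 + 1) `^ e).
  by rewrite mulr_gt0// powR_gt0 ?divr_gt0//; lra.
move=> s s1; have s0 : 0 < s by lra.
have -> : s `^ q = s `^ p * s `^ e.
  by rewrite -powRD ?(gt_eqF s0) ?implybT// /e addrC subrK.
rewrite /log_bump mulrCA ler_wpM2l ?powR_ge0// -mulrA.
rewrite -powRM ?(ltW s0) ?addr_ge0 ?expR_ge0//.
have es1 : 1 <= expR 1 + s by lra.
apply: (le_trans (powR_ln_le a0 e0 es1)); rewrite ler_wpM2l ?powR_ge0//.
by apply: ge0_ler_powR; rewrite ?nnegrE; nra.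
Qed.

Lemma B2_log_bump_ge2 : B2 (young_conj (log_bump p delta)) -> 2 <= p.
Proof.
rewrite leNgt; apply: contraPN => p2.
have [M M0 le_sqr] := log_bump_le_powR p2.
apply: (@not_B2_ge_sqr _ _ (4 * M)^-1 (Num.max 1 (2 * M))).
- by rewrite invr_gt0 mulr_gt0.
- by rewrite le_max lexx.
- by move=> t t1; apply: young_conj_ge0 log_bump_le_linear _; lra.
move=> t; rewrite ge_max => /andP[_ Mt]; apply: young_conj_ge_sqr => // s s1.
by rewrite -powR_mulrn; [exact: le_sqr|lra].
Qed.

End log_bump.

Section spike_train.
Variable R : realType.
Local Notation mu := (@lebesgue_measure R).
Variables height width : nat -> R.
Implicit Types (n : nat) (x : R).

Definition spike_support n : set R := `[n.+1%:R, n.+1%:R + width n]%classic.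

Definition sqr_spike n x : \bar R := (height n ^+ 2 * \1_(spike_support n) x)%:E.

Definition sqr_spike_train x : \bar R := (\sum_(n <oo) sqr_spike n x)%E.

(* With the sum of squares under a root, squared L2 norms add up even if the
   supports overlap. *)
Definition spike_train x : R := Num.sqrt (fine (sqr_spike_train x)).

Lemma mu_spike_support n : 0 <= width n -> mu (spike_support n) = (width n)%:E.
Proof.
rewrite le_eqVlt => /predU1P[w0|w0]; rewrite lebesgue_measure_itv/= lte_fin ltrDl.
  by rewrite -w0 ltxx.
by rewrite w0 -EFinB addrAC subrr add0r.
Qed.

Lemma sqr_spike_ge0 n x : (0 <= sqr_spike n x)%E.
Proof. by rewrite lee_fin mulr_ge0 ?sqr_ge0// indicE. Qed.

Lemma measurable_sqr_spike n : measurable_fun setT (sqr_spike n).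
Proof.
apply/measurable_EFinP; apply: measurable_funM => //.
by apply: measurable_indic; exact: measurable_itv.
Qed.

Lemma measurable_spike_train : measurable_fun setT spike_train.
Proof.
apply: (measurableT_comp (continuous_measurable_fun (@sqrt_continuous R))).
apply: (measurableT_comp (@fine_measurable R setT _)) => //.
apply: (@ge0_emeasurable_sum _ _ R setT sqr_spike xpredT) => [n x _ _|n _].
  exact: sqr_spike_ge0.
exact: measurable_sqr_spike.
Qed.

Lemma sqr_spike_train_ge0 x : (0 <= sqr_spike_train x)%E.
Proof. by apply: nneseries_ge0 => n _ _; exact: sqr_spike_ge0. Qed.

Lemma sqr_spike_train_le n x : x < n.+1%:R ->
  (sqr_spike_train x <= (\sum_(0 <= k < n) height k ^+ 2)%:E)%E.
Proof.
move=> xn; rewrite /sqr_spike_train.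
rewrite (nneseries_split 0 n) => [|k _]; last exact: sqr_spike_ge0.
rewrite [X in (_ + X)%E]eseries0 ?adde0; last first.
  move=> k; rewrite add0n => nk _; rewrite /sqr_spike indicE memNset ?mulr0//.
  rewrite /spike_support /= in_itv/= => /andP[kx _].
  have : n.+1%:R <= k.+1%:R :> R by rewrite ler_nat.
  lra.
rewrite add0n sumEFin lee_fin; apply: ler_sum => k _.
by rewrite ler_piMr ?sqr_ge0// indicE; case: (_ \in _).
Qed.

Lemma sqr_spike_train_fin_num x : sqr_spike_train x \is a fin_num.
Proof.
rewrite ge0_fin_numE ?sqr_spike_train_ge0//.
exact: le_lt_trans (sqr_spike_train_le (truncnS_gt x)) (ltry _).
Qed.

Lemma sqr_spike_trainE x : (spike_train x ^+ 2)%:E = sqr_spike_train x.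
Proof.
rewrite sqr_sqrtr ?fine_ge0 ?sqr_spike_train_ge0//.
by rewrite fineK ?sqr_spike_train_fin_num.
Qed.

Lemma spike_train_eq0 x : x < 1 -> spike_train x = 0.
Proof.
move=> x1; have := @sqr_spike_train_le 0 x x1.
rewrite big_geq// -sqr_spike_trainE lee_fin => le0.
by apply/eqP; rewrite -sqrf_eq0 eq_le le0 sqr_ge0.
Qed.

Lemma spike_train_ge n x : spike_support n x -> height n <= spike_train x.
Proof.
move=> nx; apply: (le_trans (ler_norm _)).
rewrite -(@ler_pXn2r _ 2)// ?nnegrE ?sqrtr_ge0// real_normK ?num_real//.
rewrite -lee_fin sqr_spike_trainE.
apply: le_trans (nneseries_lim_ge n.+1 (fun k _ _ => sqr_spike_ge0 k x)).
rewrite big_nat_recr//= {2}/sqr_spike indicE mem_set// mulr1.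
rewrite leeDr// sume_ge0// => k _.
exact: sqr_spike_ge0.
Qed.

Lemma Linf_loc_spike_train : Linf_loc spike_train.
Proof.
split; first exact: measurable_spike_train.
move=> a c; pose n := Num.truncn c.
exists (Num.sqrt (\sum_(0 <= k < n) height k ^+ 2)).
apply: aeW => x; rewrite in_itv/= => /andP[_ xc].
rewrite ger0_norm ?sqrtr_ge0//; apply: ler_wsqrtr.
rewrite -lee_fin fineK ?sqr_spike_train_fin_num//; apply: sqr_spike_train_le.
exact: le_lt_trans xc (truncnS_gt c).
Qed.

Lemma integral_sqr_spike_train : (forall n, 0 <= width n) ->
  (\int[mu]_x (spike_train x ^+ 2)%:E
    = \sum_(n <oo) (height n ^+ 2 * width n)%:E)%E.
Proof.
move=> w0; under eq_integral do rewrite sqr_spike_trainE.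
rewrite integral_nneseries//; last 2 first.
- exact: measurable_sqr_spike.
- by move=> n x _; exact: sqr_spike_ge0.
apply: eq_eseriesr => n _.
have mS : measurable (spike_support n) by exact: measurable_itv.
under eq_integral do rewrite /sqr_spike EFinM.
rewrite ge0_integralZl_EFin ?sqr_ge0//; last first.
  by apply/measurable_EFinP; exact: measurable_indic.
by rewrite integral_indic// setIT [X in (_ * X)%E]mu_spike_support.
Qed.

End spike_train.

Section spikes.
Variable R : realType.
Implicit Types (n : nat) (p delta : R).

(* [ln (spike_base n)] has to exceed the product of [2 ^ (n + 1)], of the squared
   ratio [n.+2 ^ 2] of height to base, and of the length [2 * n.+2] of the interval
   on which the spike is observed. *)
Definition spike_base n : R := expR (2 ^ (n + 3) * n.+2 ^ 3)%N%:R.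

Definition spike_height n : R := n.+2%:R * spike_base n.

Definition spike_width n : R := (2 ^ (n + 1))%N%:R^-1 / spike_height n ^+ 2.

Definition spikes : R -> R := spike_train spike_height spike_width.

Lemma spike_base_ge1 n : 1 <= spike_base n.
Proof. by rewrite -expR0 ler_expR. Qed.

Lemma spike_height_ge1 n : 1 <= spike_height n.
Proof. by rewrite mulr_ege1 ?spike_base_ge1// ler1n. Qed.

Let spike_height_gt0 n : 0 < spike_height n.
Proof. exact: lt_le_trans ltr01 (spike_height_ge1 n). Qed.

Let pow2_gt0 k : 0 < (2 ^ k)%N%:R :> R.
Proof. by rewrite ltr0n expn_gt0. Qed.

Lemma spike_width_gt0 n : 0 < spike_width n.
Proof. by rewrite divr_gt0 ?invr_gt0 ?pow2_gt0 ?exprn_gt0 ?spike_height_gt0. Qed.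

Lemma spike_width_le1 n : spike_width n <= 1.
Proof.
rewrite /spike_width -invfM invf_le1.
  by rewrite mulr_ege1 ?exprn_ege1 ?spike_height_ge1// ler1n expn_gt0.
by rewrite mulr_gt0 ?pow2_gt0 ?exprn_gt0 ?spike_height_gt0.
Qed.

Lemma L2norm_spikes : L2norm spikes = 1%E.
Proof.
rewrite L2normE integral_sqr_spike_train => [|n]; last exact/ltW/spike_width_gt0.
rewrite (_ : limn _ = 1%E) ?poweR1r//.
have := @cvg_geometric_eseries_half R 1 0; rewrite expr0 divr1.
move/cvg_lim => <-//; apply: eq_eseriesr => n _.
by rewrite /spike_width mulrC divfK ?mul1r// expf_eq0/= gt_eqF.
Qed.

Lemma log_bump_mul_spike_width_gt n p delta : 2 <= p -> 0 < delta ->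
  2 * n.+2%:R < log_bump p delta (spike_base n) * spike_width n.
Proof.
move=> p2 d0; have s1 := spike_base_ge1 n.
have bump_ge : spike_base n ^+ 2 * ln (spike_base n)
    <= log_bump p delta (spike_base n).
  by apply: log_bump_ge_sqr_ln => //; lra.
apply: lt_le_trans (ler_wpM2r (ltW (spike_width_gt0 n)) bump_ge).
rewrite {2}/spike_base expRK /spike_width /spike_height natrM !natrX !exprD.
set N := n.+2%:R; set s := spike_base n in s1 *.
have N0 : 0 < N :> R by rewrite ltr0n.
rewrite [ltRHS](_ : _ = 4 * N); first lra.
by field; rewrite expf_neq0//= !gt_eqF//; lra.
Qed.

Lemma osc_spikes_ge n y : spike_support spike_width n y ->
  n.+1%:R * spike_base n <= `|osc spikes (- n.+2%:R) n.+2%:R y|.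
Proof.
move=> /(@spike_train_ge _ spike_height); rewrite -/spikes => height_le.
have n1 : 1 <= n.+1%:R :> R by rewrite ler1n.
have s1 := spike_base_ge1 n.
have natrS2 := @natr1 R n.+1.
have avg1 : `|avg (- n.+2%:R) n.+2%:R spikes| <= 1.
  rewrite -lee_fin -[leRHS]L2norm_spikes; apply: normr_avg_le_L2norm; first lra.
  exact: measurable_spike_train.
rewrite normr_id; apply: le_trans (ler_norm _).
have := ler_norm (avg (- n.+2%:R) n.+2%:R spikes).
by move: height_le; rewrite /spike_height; nra.
Qed.

Lemma lux_norm_osc_spikes_ge n p delta : 2 <= p -> 0 < delta ->
  (n.+1%:R%:E <= lux_norm (log_bump p delta) (- n.+2%:R) n.+2%:R
                   (osc spikes (- n.+2%:R) n.+2%:R))%E.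
Proof.
move=> p2 d0; have w0 := spike_width_gt0 n; have w1 := spike_width_le1 n.
have n0 : 0 < n.+1%:R :> R by [].
have natrS2 := @natr1 R n.+1.
apply: (@lux_norm_ge _ _ _ _ _ _ (spike_base n) (spike_support spike_width n)) => //.
- lra.
- exact: log_bump_ge0.
- by apply: log_bump_homo => //; lra.
- exact: measurable_itv.
- by move=> x; rewrite /spike_support /= !in_itv/=; lra.
- exact: expR_gt0.
- by move=> y; exact: osc_spikes_ge.
rewrite [X in (_ * X)%E]mu_spike_support ?ltW// -EFinM lte_fin opprK.
by have := log_bump_mul_spike_width_gt n p2 d0; lra.
Qed.

End spikes.

Section spikes_half_line.
Variable R : realType.

Lemma lux_norm_osc_half_line_ge p delta (L : R) : 1 < p -> 0 < delta -> 0 < L ->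
  ((4^-1)%:E <= lux_norm (log_bump p delta) (- L) L (osc (@half_line R) (- L) L))%E.
Proof.
move=> p1 d0 L0.
apply: (@lux_norm_ge _ _ _ _ _ _ 2 `[- L, L]%classic) => //.
- lra.
- exact: log_bump_ge0.
- exact: log_bump_homo.
- by move=> y _; rewrite osc_half_line// ger0_norm//; lra.
rewrite [X in (_ * X)%E]lebesgue_measure_itv/= lte_fin ifT; last lra.
rewrite -EFinB -EFinM lte_fin ltr_pMl; last lra.
apply: lt_le_trans (log_bump_ge_powR p1 d0 _) => //.
by apply: lt_le_trans (le1r_powR _ (ltW p1)); lra.
Qed.

Lemma S_AB_spikes_half_line (A B : R -> R) :
  is_log_bump A -> is_log_bump B -> B2 (young_conj A) ->
  S_AB A B (@spikes R) (@half_line R) = +oo%E.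
Proof.
move=> [p [delta [p1 [d0 ->]]]] [q [eta [q1 [e0 ->]]]] B2A.
have p2 := B2_log_bump_ge2 p1 d0 B2A.
apply: (@ereal_sup_linear_pinfty _ _ 4^-1) => // n.
have L0 : 0 < n.+2%:R :> R by rewrite ltr0n.
eexists; first by exists (- n.+2%:R, n.+2%:R) => //=; lra.
rewrite mulrC EFinM; apply: lee_pmul; rewrite ?lee_fin//.
  exact: lux_norm_osc_spikes_ge.
exact: lux_norm_osc_half_line_ge.
Qed.

Lemma T_C_spikes_half_line (C : R -> R) :
  is_log_bump C -> B2 (young_conj C) -> T_C C (@spikes R) (@half_line R) = +oo%E.
Proof.
move=> [p [delta [p1 [d0 ->]]]] B2C; have p2 := B2_log_bump_ge2 p1 d0 B2C.
apply: (@ereal_sup_linear_pinfty _ _ 2^-1) => // n.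
have L0 : 0 < n.+2%:R :> R by rewrite ltr0n.
eexists; first by exists (- n.+2%:R, n.+2%:R) => //=; lra.
under [X in lux_norm _ _ _ X]eq_fun do rewrite osc_half_line// mulrC.
by rewrite lux_norm_scale// EFinM lee_wpmul2l// lux_norm_osc_spikes_ge.
Qed.

End spikes_half_line.

Theorem theorem4p7 (R : realType) :
  exists b1 b2 : R -> R,
    [/\ Linf_loc b1, Linf_loc b2,
        L2_bounded (CbH b1 b2),
        (forall A B : R -> R, is_log_bump A -> is_log_bump B ->
            B2 (young_conj A) -> B2 (young_conj B) ->
            S_AB A B b1 b2 = +oo%E)
      & (forall C : R -> R, is_log_bump C -> B2 (young_conj C) ->
            T_C C b1 b2 = +oo%E)].
Proof.
exists (@spikes R), (@half_line R); split.
- exact: Linf_loc_spike_train.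
- exact: Linf_loc_half_line.
- apply: L2_bounded_CbH_half_line; first exact: measurable_spike_train.
  + by move=> x; exact: spike_train_eq0.
  + by rewrite L2norm_spikes.
- by move=> A B bumpA bumpB B2A _; exact: S_AB_spikes_half_line.
- exact: T_C_spikes_half_line.
Qed.
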